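(* Let $n,m$ be positive integers. (i) Suppose $u_1,\ldots,u_m$ are linearly independent real vector fields on $S(\mathbb{R}^{2n})$. Then $r_{\mathbb C}^{-1}\circ u_1\circ r_{\mathbb C},\ldots,r_{\mathbb C}^{-1}\circ u_m\circ r_{\mathbb C}$ are linearly independent complex vector fields on $S(\mathbb{C}^n)$ if and only if $u_1,\ldots,u_m,\,r_{\mathbb{C},i}\circ u_1,\ldots,r_{\mathbb{C},i}\circ u_m$ are linearly independent real vector fields on $S(\mathbb{R}^{2n})$. (ii) Suppose $v_1,\ldots,v_m$ are linearly independent complex vector fields on $S(\mathbb{C}^{2n})$. Then $c_{\mathbb H}^{-1}\circ v_1\circ c_{\mathbb H},\ldots,c_{\mathbb H}^{-1}\circ v_m\circ c_{\mathbb H}$ are linearly independent quaternionic vector fields on $S(\mathbb{H}^n)$ if and only if $v_1,\ldots,v_m,\,c_{\mathbb{H},j}\circ v_1,\ldots,c_{\mathbb{H},j}\circ v_m$ are linearly independent complex vector fields on $S(\mathbb{C}^{2n})$. (iii) Suppose $u_1,\ldots,u_m$ are linearly independent real vector fields on $S(\mathbb{R}^{4n})$. Then $r_{\mathbb H}^{-1}\circ u_1\circ r_{\mathbb H},\ldots,r_{\mathbb H}^{-1}\circ u_m\circ r_{\mathbb H}$ are linearly independent quaternionic vector fields on $S(\mathbb{H}^n)$ if and only if the $4m$ functions consisting of $u_l$ and $r_{\mathbb{H},t}\circ u_l$ for $l=1,\ldots,m$ and $t\in\{i,j,k\}$ are linearly independent real vector fields on $S(\mathbb{R}^{4n})$.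
   Context: $\mathbb{F}$ denotes one of $\mathbb{R}$, $\mathbb{C}$, $\mathbb{H}$ with usual conjugation. $\mathbb{F}^n$ is a right inner product space over $\mathbb{F}$ with $\langle(x_1,\ldots,x_n)|(y_1,\ldots,y_n)\rangle_{\mathbb F}=\sum_{m=1}^n\bar{x}_m y_m$, and $S(\mathbb{F}^n)=\{x\in\mathbb{F}^n:\langle x|x\rangle_{\mathbb F}=1\}$. An $\mathbb{F}$-vector field on $S(\mathbb{F}^n)$ (real, complex, quaternionic for $\mathbb{F}=\mathbb{R},\mathbb{C},\mathbb{H}$) is a continuous function $v:S(\mathbb{F}^n)\to\mathbb{F}^n-\{0\}$ with $\langle x|v(x)\rangle_{\mathbb F}=0$ for every $x\in S(\mathbb{F}^n)$. $\mathbb{F}$-vector fields $v_1,\ldots,v_m$ on $S(\mathbb{F}^n)$ are linearly independent if $v_1(x),\ldots,v_m(x)$ are linearly independent over $\mathbb{F}$ (in the right $\mathbb{F}$-vector space $\mathbb{F}^n$) for all $x\in S(\mathbb{F}^n)$. The realification $r_{\mathbb C}:\mathbb{C}^n\to\mathbb{R}^{2n}$ is $r_{\mathbb C}(a_1+b_1i,\ldots,a_n+b_ni)=(a_1,b_1,\ldots,a_n,b_n)$. The complexification $c_{\mathbb H}:\mathbb{H}^n\to\mathbb{C}^{2n}$ is $c_{\mathbb H}(a_1+b_1i+c_1j+d_1k,\ldots,a_n+b_ni+c_nj+d_nk)=(a_1+b_1i,\,d_1+c_1i,\ldots,a_n+b_ni,\,d_n+c_ni)$. The realification $r_{\mathbb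 H}:\mathbb{H}^n\to\mathbb{R}^{4n}$ is $r_{\mathbb H}=r_{\mathbb C}\circ c_{\mathbb H}$. These are norm-preserving bijections, so they and their inverses restrict to the unit spheres. For $t\in\mathbb{F}$, $\alpha_t:\mathbb{F}^n\to\mathbb{F}^n$ is right multiplication, $\alpha_t(x)=x\cdot t$. Put $r_{\mathbb{C},i}=r_{\mathbb C}\circ\alpha_i\circ r_{\mathbb C}^{-1}:\mathbb{R}^{2n}\to\mathbb{R}^{2n}$, $c_{\mathbb{H},j}=c_{\mathbb H}\circ\alpha_j\circ c_{\mathbb H}^{-1}:\mathbb{C}^{2n}\to\mathbb{C}^{2n}$, and, for $t\in\{i,j,k\}$, $r_{\mathbb{H},t}=r_{\mathbb H}\circ\alpha_t\circ r_{\mathbb H}^{-1}:\mathbb{R}^{4n}\to\mathbb{R}^{4n}$. *)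

(* Defs.v *)
From HB Require Import structures.
From mathcomp Require Import all_boot all_order all_algebra complex ring.
From mathcomp Require Import all_classical all_reals all_analysis.
Import numFieldNormedType.Exports.

Set Implicit Arguments.
Unset Strict Implicit.
Unset Printing Implicit Defensive.

Import Order.TTheory GRing.Theory Num.Theory.
Local Open Scope classical_set_scope.
Local Open Scope ring_scope.

(* The common interface of R, C and H: a topological carrier with a possibly
   noncommutative ring structure and a conjugation (an involutive
   anti-automorphism). *)
HB.mixin Record isConjRing F of GRing.NzRing F := {
  conjF : F -> F;
  conjFK : involutive conjF;
  conjFD : {morph conjF : x y / x + y};
  conjFM : forall x y, conjF (x * y) = conjF y * conjF x }.

#[short(type="conjRingType")]
HB.structure Definition ConjRing := {F of GRing.NzRing F & isConjRing F}.

#[short(type="conjTopRingType")]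
HB.structure Definition ConjTopRing := {F of Topological F & ConjRing F}.

Section VectorFields.
Variables (F : conjTopRingType) (n : nat).
Implicit Types (x y : 'rV[F]_n) (v : 'rV[F]_n -> 'rV[F]_n).

Definition inner x y : F := \sum_(m < n) conjF (x 0 m) * y 0 m.

Definition usphere : set 'rV[F]_n := [set x | inner x x = 1].

(* Right multiplication by a scalar; MathComp's [*:] on rows acts on the
   left, which differs over H. *)
Definition alpha (t : F) x : 'rV[F]_n := \row_m (x 0 m * t).

Definition rlin_indep (I : finType) (w : I -> 'rV[F]_n) : Prop :=
  forall t : I -> F, \sum_l alpha (t l) (w l) = 0 -> forall l, t l = 0.

(* A map S(F^n) -> F^n - {0} is represented by a total map on F^n of which
   only the restriction to the sphere matters. *)
Definition vector_field v : Prop :=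
  [/\ {within usphere, continuous v},
      forall x, usphere x -> v x != 0
    & forall x, usphere x -> inner x (v x) = 0].

Definition lin_indep_vector_fields (I : finType)
    (v : I -> 'rV[F]_n -> 'rV[F]_n) : Prop :=
  (forall l, vector_field (v l)) /\
  (forall x, usphere x -> rlin_indep (fun l => v l x)).

End VectorFields.

Definition join_family (I J : finType) (T : Type) (u : I -> T) (v : J -> T)
    (s : I + J) : T :=
  match s with inl l => u l | inr l => v l end.

Section RealConj.
Variable R : realType.

Lemma real_conjK : involutive (@id R). Proof. by []. Qed.

Lemma real_conjD : {morph @id R : x y / x + y}. Proof. by []. Qed.

Lemma real_conjM (x y : R) : id (x * y) = id y * id x.
Proof. exact: mulrC. Qed.

#[non_forgetful_inheritance]
HB.instance Definition _ :=
  isConjRing.Build R real_conjK real_conjD real_conjM.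

End RealConj.

(* The topology of R[i] is the one of its norm. *)
HB.instance Definition _ (R : realType) := NormedModule.copy R[i] R[i]^o.

Section ComplexConj.
Variable R : realType.

Lemma complex_conjD : {morph @conjc R : x y / x + y}.
Proof. exact: raddfD. Qed.

Lemma complex_conjM (x y : R[i]) : conjc (x * y) = conjc y * conjc x.
Proof. by rewrite rmorphM mulrC. Qed.

HB.instance Definition _ :=
  isConjRing.Build R[i] (@conjcK R) complex_conjD complex_conjM.

End ComplexConj.

(* [Quat a b c d] is a + b i + c j + d k. *)
Record quat (R : Type) : Type := Quat { qre : R; qi : R; qj : R; qk : R }.

Definition quat_coords (R : Type) (x : quat R) : R * R * R * R :=
  (qre x, qi x, qj x, qk x).
Definition coords_quat (R : Type) (p : R * R * R * R) : quat R :=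
  let: (a, b, c, d) := p in Quat a b c d.
Lemma quat_coordsK (R : Type) : cancel (@quat_coords R) (@coords_quat R).
Proof. by case. Qed.

HB.instance Definition _ (R : choiceType) :=
  Choice.copy (quat R) (can_type (@quat_coordsK R)).

Section QuatRing.
Variable R : comNzRingType.
Implicit Types x y z : quat R.

Definition addq x y : quat R :=
  Quat (qre x + qre y) (qi x + qi y) (qj x + qj y) (qk x + qk y).
Definition oppq x : quat R := Quat (- qre x) (- qi x) (- qj x) (- qk x).
Definition mulq x y : quat R :=
  let: Quat a b c d := x in let: Quat a' b' c' d' := y in
  Quat (a * a' - b * b' - c * c' - d * d')
       (a * b' + b * a' + c * d' - d * c')
       (a * c' - b * d' + c * a' + d * b')
       (a * d' + b * c' - c * b' + d * a').
Definition conjq x : quat R :=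
  let: Quat a b c d := x in Quat a (- b) (- c) (- d).

Lemma addqA : associative addq.
Proof. by move=> [????] [????] [????]; congr Quat; rewrite /= addrA. Qed.
Lemma addqC : commutative addq.
Proof. by move=> [????] [????]; congr Quat; rewrite /= addrC. Qed.
Lemma add0q : left_id (Quat 0 0 0 0) addq.
Proof. by move=> [????]; congr Quat; rewrite /= add0r. Qed.
Lemma addNq : left_inverse (Quat 0 0 0 0) oppq addq.
Proof. by move=> [????]; congr Quat; rewrite /= addNr. Qed.

HB.instance Definition _ :=
  GRing.isZmodule.Build (quat R) addqA addqC add0q addNq.

Lemma mulqA : associative mulq.
Proof. by move=> [????] [????] [????]; congr Quat; ring. Qed.
Lemma mul1q : left_id (Quat 1 0 0 0) mulq.
Proof. by move=> [????]; congr Quat; ring. Qed.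
Lemma mulq1 : right_id (Quat 1 0 0 0) mulq.
Proof. by move=> [????]; congr Quat; ring. Qed.
Lemma mulqDl : left_distributive mulq addq.
Proof. by move=> [????] [????] [????]; congr Quat => /=; ring. Qed.
Lemma mulqDr : right_distributive mulq addq.
Proof. by move=> [????] [????] [????]; congr Quat => /=; ring. Qed.
Lemma oneq_neq0 : Quat 1 0 0 0 != 0 :> quat R.
Proof. by apply/eqP => -[] /eqP; rewrite oner_eq0. Qed.

HB.instance Definition _ := GRing.Zmodule_isNzRing.Build (quat R)
  mulqA mul1q mulq1 mulqDl mulqDr oneq_neq0.

Lemma conjqK : involutive conjq.
Proof. by move=> [????]; rewrite /= !opprK. Qed.
Lemma conjqD : {morph conjq : x y / x + y}.
Proof. by move=> [????] [????]; congr Quat; rewrite /= opprD. Qed.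
Lemma conjqM x y : conjq (x * y) = conjq y * conjq x.
Proof. by case: x y => [????] [????]; congr Quat; ring. Qed.

HB.instance Definition _ := isConjRing.Build (quat R) conjqK conjqD conjqM.

End QuatRing.

(* H carries the topology of R^4. *)
HB.instance Definition _ (R : realType) :=
  Topological.copy (quat R) (initial_topology (@quat_coords R)).

Section Coordinates.
Variable n : nat.

Lemma half_ord_subproof (p : 'I_(2 * n)) : (p./2 < n)%N.
Proof. by rewrite ltn_half_double -mul2n. Qed.
Definition half_ord (p : 'I_(2 * n)) : 'I_n := Ordinal (half_ord_subproof p).

Lemma even_ord_subproof (q : 'I_n) : (2 * q < 2 * n)%N.
Proof. by rewrite ltn_mul2l /=. Qed.
Definition even_ord (q : 'I_n) : 'I_(2 * n) := Ordinal (even_ord_subproof q).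

Lemma odd_ord_subproof (q : 'I_n) : ((2 * q).+1 < 2 * n)%N.
Proof. by rewrite !mul2n -doubleS leq_double. Qed.
Definition odd_ord (q : 'I_n) : 'I_(2 * n) := Ordinal (odd_ord_subproof q).

(* [split_row f g x] = (f x_1, g x_1, f x_2, g x_2, ...), and
   [merge_row h y] = (h y_1 y_2, h y_3 y_4, ...). *)
Definition split_row (A B : Type) (f g : A -> B) (x : 'rV[A]_n) :
    'rV[B]_(2 * n) :=
  \row_p (if odd p then g (x 0 (half_ord p)) else f (x 0 (half_ord p))).
Definition merge_row (A B : Type) (h : B -> B -> A) (y : 'rV[B]_(2 * n)) :
    'rV[A]_n :=
  \row_q h (y 0 (even_ord q)) (y 0 (odd_ord q)).

Lemma split_rowK (A B : Type) (f g : A -> B) (h : B -> B -> A) :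
  (forall a, h (f a) (g a) = a) -> cancel (split_row f g) (merge_row h).
Proof.
move=> hfg x; apply/rowP => q; rewrite !mxE /= !mul2n /= odd_double /=.
have -> : half_ord (even_ord q) = q.
  by apply/val_inj; rewrite /= mul2n doubleK.
have -> : half_ord (odd_ord q) = q.
  by apply/val_inj; rewrite /= mul2n uphalf_double.
exact: hfg.
Qed.

Lemma merge_rowK (A B : Type) (f g : A -> B) (h : B -> B -> A) :
  (forall a b, f (h a b) = a) -> (forall a b, g (h a b) = b) ->
  cancel (merge_row h) (split_row f g).
Proof.
move=> fh gh y; apply/rowP => p; rewrite !mxE /=.
case: ifP => op; rewrite ?fh ?gh; congr (y 0 _); apply/val_inj => /=.
- by rewrite mul2n -[RHS]odd_double_half op.
- by rewrite mul2n -[RHS]odd_double_half op.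
Qed.

End Coordinates.

Section Identifications.
Variables (R : realType) (n : nat).

Definition rC : 'rV[R[i]]_n -> 'rV[R]_(2 * n) :=
  split_row (@complex.Re R) (@complex.Im R).
Definition rC_inv : 'rV[R]_(2 * n) -> 'rV[R[i]]_n := merge_row (@Complex R).

Lemma rCK : cancel rC rC_inv.
Proof. by apply: split_rowK => -[]. Qed.
Lemma rC_invK : cancel rC_inv rC.
Proof. exact: merge_rowK. Qed.

Definition cH : 'rV[quat R]_n -> 'rV[R[i]]_(2 * n) :=
  split_row (fun q => Complex (qre q) (qi q)) (fun q => Complex (qk q) (qj q)).
Definition cH_inv : 'rV[R[i]]_(2 * n) -> 'rV[quat R]_n :=
  merge_row (fun z w : R[i] =>
    Quat (complex.Re z) (complex.Im z) (complex.Im w) (complex.Re w)).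

Lemma cHK : cancel cH cH_inv.
Proof. by apply: split_rowK => -[]. Qed.
Lemma cH_invK : cancel cH_inv cH.
Proof. by apply: merge_rowK => -[? ?] []. Qed.

End Identifications.

Arguments rC {R n}.
Arguments rC_inv {R n}.
Arguments cH {R n}.
Arguments cH_inv {R n}.

(* R^{4n} is 'rV[R]_(2 * (2 * n)), the codomain of the composite. *)
Definition rH (R : realType) (n : nat) :
  'rV[quat R]_n -> 'rV[R]_(2 * (2 * n)) := rC \o cH.
Definition rH_inv (R : realType) (n : nat) :
  'rV[R]_(2 * (2 * n)) -> 'rV[quat R]_n := cH_inv \o rC_inv.
Arguments rH {R n}.
Arguments rH_inv {R n}.

Lemma rHK (R : realType) (n : nat) : cancel (@rH R n) (@rH_inv R n).
Proof. by move=> x; rewrite /rH /rH_inv /= rCK cHK. Qed.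
Lemma rH_invK (R : realType) (n : nat) : cancel (@rH_inv R n) (@rH R n).
Proof. by move=> x; rewrite /rH /rH_inv /= cH_invK rC_invK. Qed.

Section Units.
Variables (R : realType) (n : nat).

Definition iC : R[i] := Complex 0 1.
Definition iH : quat R := Quat 0 1 0 0.
Definition jH : quat R := Quat 0 0 1 0.
Definition kH : quat R := Quat 0 0 0 1.

Definition rC_i : 'rV[R]_(2 * n) -> 'rV[R]_(2 * n) :=
  rC \o alpha iC \o rC_inv.
Definition cH_j : 'rV[R[i]]_(2 * n) -> 'rV[R[i]]_(2 * n) :=
  cH \o alpha jH \o cH_inv.
Definition rH_t (t : quat R) :
    'rV[R]_(2 * (2 * n)) -> 'rV[R]_(2 * (2 * n)) :=
  rH \o alpha t \o rH_inv.

End Units.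

Arguments rC_i {R n}.
Arguments cH_j {R n}.
Arguments rH_t {R n}.

(* Main.v *)
Require Import Defs.
From HB Require Import structures.
From mathcomp Require Import all_boot all_order all_algebra complex.
From mathcomp Require Import all_classical all_reals all_analysis.
From mathcomp Require Import ring lra.
Import numFieldNormedType.Exports.

(* All three equivalences are restriction of scalars along F -> K.  Let (e_s)
   be a basis of K as a right F-vector space with respect to which the
   identification phi : K^n -> F^N is F-linear, and let pi : K -> F be the
   component of e_s = 1, so that <phi x|phi y>_F = pi <x|y>_K.  Writing
   scalars t_l = sum_s e_s a_(s,l) turns a K-linear relation among vectors w_l
   into an F-linear relation among the w_l e_s.  Moreover
   <x|w e_s>_K = <x|w>_K e_s, and p = 0 in K as soon as pi (p e_s) = 0 for
   every s, so that w is K-orthogonal to x if and only if every phi (w e_s)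
   is F-orthogonal to phi x. *)

Set Implicit Arguments.
Unset Strict Implicit.
Unset Printing Implicit Defensive.

Import Order.TTheory GRing.Theory Num.Theory.
Local Open Scope classical_set_scope.
Local Open Scope ring_scope.

(** * Continuity for matrices, pairs and restrictions to a subset *)

Lemma continuous_mx (T U : topologicalType) (m n : nat)
    (f : T -> 'M[U]_(m, n)) :
  (forall i j, continuous (fun x => f x i j)) -> continuous f.
Proof.
move=> fc x A [P fxP sPA].
apply: (@filterS _ (nbhs x) _ _ _ (fun y Py => sPA (f y) Py)).
apply: filter_forall => i; apply: filter_forall => j.
exact: fc (fxP i j).
Qed.

Lemma continuous_mx_entry (U : topologicalType) (m n : nat) i j :
  continuous (fun M : 'M[U]_(m, n) => M i j).
Proof.
move=> M B MB.
exists (fun i' j' => if (i' == i) && (j' == j) then B else setT).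
  by move=> i' j'; case: ifP => [/andP[/eqP-> /eqP->]//|_]; exact: filterT.
by move=> M' /(_ i j); rewrite !eqxx.
Qed.

Lemma continuousT_comp (T U V : topologicalType) (f : T -> U) (g : U -> V) :
  continuous f -> continuous g -> continuous (g \o f).
Proof. by move=> fc gc x; apply: continuous_comp; [exact: fc|exact: gc]. Qed.

Lemma continuousT_fst (T U : topologicalType) : continuous (@fst T U).
Proof. by move=> x; exact: cvg_fst. Qed.

Lemma continuousT_snd (T U : topologicalType) : continuous (@snd T U).
Proof. by move=> x; exact: cvg_snd. Qed.

Lemma continuous_pair (T U V : topologicalType) (f : T -> U) (g : T -> V) :
  continuous f -> continuous g -> continuous (fun x => (f x, g x)).
Proof. by move=> fc gc x; apply: cvg_pair; [exact: fc|exact: gc]. Qed.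

(** Serves to conjugate a field, continuous only on its sphere, by identifications that are
    continuous everywhere. *)
Lemma within_continuous_comp (S T U V : topologicalType) (A : set S)
    (B : set T) (f : S -> T) (u : T -> U) (g : U -> V) :
  continuous f -> (forall x, A x -> B (f x)) -> continuous g ->
  {within B, continuous u} -> {within A, continuous (g \o u \o f)}.
Proof.
move=> fc AB gc /subspace_continuousP uc; apply/subspace_continuousP => x Ax.
apply: (@continuous_cvg _ _ _ _ _ (u \o f) g); first exact: gc.
move=> W /(uc _ (AB _ Ax)) uW.
(* A neighbourhood within [B] is an ordinary neighbourhood of the set cut out by an implication from
   [B], so continuity of [f] applies to it directly. *)
have /fc : nbhs (f x) (fun z => B z -> W (u z)) by exact: uW.
change (nbhs x (f @^-1` [set z | B z -> W (u z)]) ->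
  nbhs x (fun y => A y -> W (u (f y)))).
by apply: filterS => y fyW /AB; exact: fyW.
Qed.

(** * Continuity of the real coordinates of C and of its multiplication *)

Section ComplexContinuity.
Variable R : realType.

Lemma continuous_Re : continuous (@complex.Re R : R[i] -> R).
Proof.
move=> z; apply/(cvgrPdist_lt (FF := @nbhs_filter R[i] z)) => e e0.
(* Balls of [R[i]] have radii in [R[i]], so the real radius is embedded first; then |Re z| <= |z|
   concludes. *)
have eC : 0 < e%:C%C by rewrite ltcR.
have := @nbhsx_ballx _ R[i] z _ eC.
apply: (@filterS _ (nbhs z)) => y.
rewrite /ball /= -(raddfB (@complex.Re R)) -ltcR.
exact/le_lt_trans/normc_ge_Re.
Qed.

Lemma continuous_mulcr (t : R[i]) : continuous (fun z : R[i] => z * t).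
Proof.
move=> z; apply: (@cvgMr_tmp R[i] R[i] (nbhs z) (@nbhs_filter R[i] z)).
exact: cvg_id.
Qed.

Lemma continuous_Im : continuous (@complex.Im R : R[i] -> R).
Proof.
have -> : @complex.Im R = @complex.Re R \o (fun z : R[i] => z * - 'i%C).
  by apply/funext => -[a b] /=; ring.
by apply: continuousT_comp; [exact: continuous_mulcr|exact: continuous_Re].
Qed.

Lemma continuous_complex (T : topologicalType) (f g : T -> R) :
  continuous f -> continuous g -> continuous (fun x => Complex (f x) (g x)).
Proof.
have rc : continuous (fun a : R => a%:C%C).
  move=> a; apply/cvgrPdist_lt => -[e e'] /=.
  (* A positive element of [R[i]] has imaginary part 0, so this radius is a positive real. *)
  rewrite ltcE /= => /andP[/eqP-> e0].
  have := nbhsx_ballx a _ e0.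
  apply: (@filterS _ (nbhs a)) => y.
  rewrite /ball /= -raddfB /= normc_def /= expr0n addr0 sqrtr_sqr.
  by rewrite ltcR.
move=> fc gc x.
rewrite (_ : (fun _ => _) = fun x => (f x)%:C%C + 'i%C * (g x)%:C%C).
  apply: cvgD; last apply: cvgMl_tmp; apply: (continuous_cvg _ (rc _)).
    exact: fc.
  exact: gc.
by apply/funext => y; rewrite [LHS]complexE.
Qed.

End ComplexContinuity.

(** * Continuity of the coordinates of H and of right multiplication *)

Section QuatContinuity.
Variable R : realType.

Lemma continuous_quat_coords : continuous (@quat_coords R).
Proof. exact: initial_continuous. Qed.

Lemma continuous_qre : continuous (@qre R : quat R -> R).
Proof.
apply: (continuousT_comp (g := fst \o fst \o fst) continuous_quat_coords).
apply: continuousT_comp (@continuousT_fst _ _) _.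
exact: continuousT_comp (@continuousT_fst _ _) (@continuousT_fst _ _).
Qed.

Lemma continuous_qi : continuous (@qi R : quat R -> R).
Proof.
apply: (continuousT_comp (g := snd \o fst \o fst) continuous_quat_coords).
apply: continuousT_comp (@continuousT_fst _ _) _.
exact: continuousT_comp (@continuousT_fst _ _) (@continuousT_snd _ _).
Qed.

Lemma continuous_qj : continuous (@qj R : quat R -> R).
Proof.
apply: (continuousT_comp (g := snd \o fst) continuous_quat_coords).
exact: continuousT_comp (@continuousT_fst _ _) (@continuousT_snd _ _).
Qed.

Lemma continuous_qk : continuous (@qk R : quat R -> R).
Proof.
exact: (continuousT_comp continuous_quat_coords (@continuousT_snd _ _)).
Qed.

Lemma continuous_Quat (T : topologicalType) (a b c d : T -> R) :
  continuous a -> continuous b -> continuous c -> continuous d ->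
  continuous (fun x => Quat (a x) (b x) (c x) (d x) : quat R).
Proof.
move=> ac bc cc dc.
apply: (@continuous_comp_initial _ _ _ (@quat_coords R)).
exact: continuous_pair (continuous_pair (continuous_pair ac bc) cc) dc.
Qed.

(** Each coordinate of a quaternion product x t has this shape in the coordinates of x, for fixed
    t. *)
Lemma continuous_lincomb4 (T : topologicalType) (f g h k : T -> R) a b c d :
  continuous f -> continuous g -> continuous h -> continuous k ->
  continuous (fun x => f x * a + g x * b + h x * c + k x * d).
Proof.
move=> fc gc hc kc x.
do 3?apply: cvgD; apply: cvgMr_tmp.
- exact: fc.
- exact: gc.
- exact: hc.
- exact: kc.
Qed.

Lemma continuous_mulqr (t : quat R) : continuous (fun x : quat R => x * t).
Proof.
case: t => a b c d.
have -> : (fun x : quat R => x * Quat a b c d) = fun x =>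
  Quat (qre x * a + qi x * - b + qj x * - c + qk x * - d)
       (qre x * b + qi x * a + qj x * d + qk x * - c)
       (qre x * c + qi x * - d + qj x * a + qk x * b)
       (qre x * d + qi x * c + qj x * - b + qk x * a).
  by apply/funext => -[? ? ? ?]; congr Quat => /=; ring.
have [cr ci] := (continuous_qre, continuous_qi).
have [cj ck] := (continuous_qj, continuous_qk).
by apply: continuous_Quat; exact: continuous_lincomb4.
Qed.

End QuatContinuity.

(** * Right scalars, the inner product and independence over one ring *)

Section RightModule.
Variables (F : conjTopRingType) (n : nat).
Implicit Types (x y : 'rV[F]_n) (s t : F).

Lemma conjF0 : conjF 0 = 0 :> F.
Proof. by apply: (addIr (conjF 0)); rewrite -conjFD !add0r. Qed.

Lemma conjF_sum (I : finType) (f : I -> F) :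
  conjF (\sum_i f i) = \sum_i conjF (f i).
Proof. exact: (big_morph _ (@conjFD F) conjF0). Qed.

Lemma conj_inner x y : conjF (inner x y) = inner y x.
Proof.
by rewrite /inner conjF_sum; apply: eq_bigr => i _; rewrite conjFM conjFK.
Qed.

Lemma alphaM s t x : alpha t (alpha s x) = alpha (s * t) x.
Proof. by apply/rowP => i; rewrite !mxE mulrA. Qed.

Lemma alpha1 x : alpha 1 x = x.
Proof. by apply/rowP => i; rewrite mxE mulr1. Qed.

Lemma alpha0 x : alpha 0 x = 0.
Proof. by apply/rowP => i; rewrite !mxE mulr0. Qed.

Lemma alpha_suml (I : finType) (t : I -> F) x :
  alpha (\sum_i t i) x = \sum_i alpha (t i) x.
Proof.
apply/rowP => j; rewrite !(mxE, summxE) mulr_sumr.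
by apply: eq_bigr => i _; rewrite mxE.
Qed.

Lemma inner_alpha x y t : inner x (alpha t y) = inner x y * t.
Proof.
by rewrite /inner mulr_suml; apply: eq_bigr => i _; rewrite mxE mulrA.
Qed.

Lemma continuous_alpha t :
  continuous (fun s => s * t) -> continuous (@alpha F n t).
Proof.
move=> tc; apply: continuous_mx => i j.
have -> : (fun x => alpha t x i j) = (fun s => s * t) \o (fun x => x i j).
  by apply/funext => x; rewrite /= mxE ord1.
move=> x; apply: continuous_comp; last exact: tc.
exact: continuous_mx_entry.
Qed.

Lemma rlin_indep_neq0 (I : finType) (w : I -> 'rV[F]_n) l :
  rlin_indep w -> w l != 0.
Proof.
move=> wfree; apply/eqP => wl0.
(* If [w l] were 0, the coefficients that are 1 at l and 0 elsewhere would give a nontrivial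
   relation. *)
have /eqP : (l == l)%:R = 0 :> F; last by rewrite eqxx oner_eq0.
apply: (wfree (fun j => (j == l)%:R)).
rewrite (bigD1 l) //= big1 => [|j /negPf ->].
  by rewrite eqxx alpha1 addr0.
exact: alpha0.
Qed.

(** Passes between the disjoint sums that index [join_family] and the pairs (basis element, field)
    natural for restriction of scalars. *)
Lemma lin_indep_vector_fields_reindex (I J : finType) (h : J -> I)
    (w : I -> 'rV[F]_n -> 'rV[F]_n) :
  bijective h ->
  lin_indep_vector_fields (w \o h) <-> lin_indep_vector_fields w.
Proof.
move=> bij_h; have [g hK gK] := bij_h.
split=> -[wv wfree]; split=> [l|x xS t wt0 l].
- by rewrite -(gK l); exact: wv.
- rewrite -(gK l); apply: (wfree x xS (t \o h)).
  by rewrite -[RHS]wt0 [RHS](reindex h) //; exact: onW_bij.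
- exact: wv.
- rewrite -(hK l); apply: (wfree x xS (t \o g)).
  rewrite -[RHS]wt0 (reindex h) /=; last exact: onW_bij.
  by apply: eq_bigr => j _; rewrite hK.
Qed.

End RightModule.

(** * Restriction of scalars from K to F *)

Section RestrictionOfScalars.
Variables (F K : conjTopRingType) (n N : nat) (S : finType).
Variables (e : S -> K) (iota : F -> K) (pi : K -> F).
Variables (phi : 'rV[K]_n -> 'rV[F]_N) (psi : 'rV[F]_N -> 'rV[K]_n).

Hypothesis iota0 : iota 0 = 0.
Hypothesis e_span : forall t, exists a : S -> F, t = \sum_s e s * iota (a s).
Hypothesis e_free : forall a : S -> F,
  \sum_s e s * iota (a s) = 0 -> forall s, a s = 0.
Hypothesis e_cont : forall s, continuous (fun t : K => t * e s).
Hypothesis pi_eq0 : forall p, (forall s, pi (p * e s) = 0) <-> p = 0.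
Hypothesis pi_eq1 : forall p, conjF p = p -> pi p = 1 <-> p = 1.
Hypothesis phiK : cancel phi psi.
Hypothesis psiK : cancel psi phi.
Hypothesis phi_cont : continuous phi.
Hypothesis psi_cont : continuous psi.
Hypothesis phiD : {morph phi : x y / x + y}.
Hypothesis phiZ : forall a x, phi (alpha (iota a) x) = alpha a (phi x).
Hypothesis inner_phi : forall x y, inner (phi x) (phi y) = pi (inner x y).

Lemma phi0 : phi 0 = 0.
Proof. by apply: (addIr (phi 0)); rewrite -phiD !add0r. Qed.

Lemma phi_eq0 x : phi x = 0 -> x = 0.
Proof. by move=> x0; apply: (can_inj phiK); rewrite phi0. Qed.

(** The scalar <x|x>_K is its own conjugate, which is what [pi_eq1] asks in order to detect the
    value 1 from its [pi] component. *)
Lemma usphere_phi x : usphere (phi x) <-> usphere x.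
Proof. by rewrite /usphere /= inner_phi; apply: pi_eq1; exact: conj_inner. Qed.

Lemma usphere_psi x : usphere (psi x) <-> usphere x.
Proof. by rewrite -{2}(psiK x); split=> /usphere_phi. Qed.

Lemma rlin_indep_restrict (I : finType) (v : I -> 'rV[K]_n) :
  rlin_indep v <-> rlin_indep (fun j : S * I => phi (alpha (e j.1) (v j.2))).
Proof.
(* Scalars act on the right, so acting by e_s and then by [iota a] is acting by e_s * [iota a];
   [phiZ] and additivity then collect everything under [phi]. *)
have phi_sum (a : S * I -> F) :
    \sum_j alpha (a j) (phi (alpha (e j.1) (v j.2))) =
    phi (\sum_l alpha (\sum_s e s * iota (a (s, l))) (v l)).
  rewrite (big_morph _ phiD phi0).
  under [RHS]eq_bigr do rewrite alpha_suml (big_morph _ phiD phi0).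
  rewrite exchange_big pair_bigA; apply: eq_bigr => -[s l] _ /=.
  by rewrite -alphaM phiZ.
split=> vfree t.
- rewrite phi_sum => /phi_eq0 /vfree t0 [s l].
  exact: (e_free (t0 l)).
(* Choose the coordinates of every K-coefficient in the basis e; the K-relation becomes an
   F-relation among them. *)
- move=> vt0 l; pose a (s : S) (l : I) : F := projT1 (cid (e_span (t l))) s.
  have tE k : t k = \sum_s e s * iota (a s k).
    exact: (projT2 (cid (e_span (t k)))).
  have a0 : forall j, a j.1 j.2 = 0.
    apply: vfree; rewrite phi_sum /=.
    by under eq_bigr do rewrite -tE; rewrite vt0 phi0.
  by rewrite tE big1 // => s _; rewrite (a0 (s, l)) iota0 mulr0.
Qed.

(** In both directions nonvanishing follows from independence and continuity from composition; only
    tangency has to be carried from one inner product to the other. *)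
Lemma restriction_of_scalars (I : finType) (u : I -> 'rV[F]_N -> 'rV[F]_N) :
  (forall l, {within usphere (n := N), continuous u l}) ->
  lin_indep_vector_fields (fun l => psi \o u l \o phi) <->
  lin_indep_vector_fields
    (fun j : S * I => (phi \o alpha (e j.1) \o psi) \o u j.2).
Proof.
move=> uc; split=> -[wv wfree].
- have free x : usphere x -> rlin_indep (fun j : S * I =>
      ((phi \o alpha (e j.1) \o psi) \o u j.2) x).
    move=> /usphere_psi /wfree /rlin_indep_restrict; rewrite /= psiK; exact.
  split=> // -[s l]; split=> [|x /free/(rlin_indep_neq0 (s, l))//|x xS /=].
  + apply: (within_continuous_comp (f := id) (g := phi \o alpha (e s) \o psi)
      _ _ _ (uc l)) => //.
      by move=> ?; exact: cvg_id.
    apply: continuousT_comp psi_cont (continuousT_comp _ phi_cont).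
    exact: continuous_alpha.
  (* The F-inner product is [pi] of <psi x|psi (u x)>_K e_s, and the K-inner product is 0 by
     tangency over K. *)
  + rewrite -{1}(psiK x) inner_phi inner_alpha.
    have [_ _ /(_ (psi x))] := wv l; rewrite /= psiK => -> //.
      exact: (pi_eq0 0).2.
    exact/usphere_psi.
- have free x : usphere x -> rlin_indep (fun l : I => (psi \o u l \o phi) x).
    by move=> /usphere_phi /wfree ?; apply/rlin_indep_restrict.
  split=> // l; split=> [|x /free/(rlin_indep_neq0 l)//|x xS /=].
  + by apply: (within_continuous_comp _ _ _ (uc l)) => // x /usphere_phi.
  (* The test of <x|w>_K against e_s is exactly the F-tangency at [phi x] of the field with index
     (s, l). *)
  + apply/pi_eq0 => s; rewrite -inner_alpha -inner_phi.
    have [_ _] := wv (s, l); apply; exact/usphere_phi.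
Qed.

End RestrictionOfScalars.

(** * Interleaved rows: sums, continuity, linearity and inner products *)

Lemma half_even_ord n (q : 'I_n) : half_ord (even_ord q) = q.
Proof. by apply: val_inj; rewrite /= mul2n doubleK. Qed.

Lemma half_odd_ord n (q : 'I_n) : half_ord (odd_ord q) = q.
Proof. by apply: val_inj; rewrite /= mul2n uphalf_double. Qed.

Lemma big_ord_even_odd (V : nmodType) (n : nat) (f : 'I_(2 * n) -> V) :
  \sum_p f p = \sum_(q < n) (f (even_ord q) + f (odd_ord q)).
Proof.
(* Here [true] marks the even position because [big_bool] lists [true] first; hence the negated
   parity in the inverse map below. *)
pose h (r : 'I_n * bool) := if r.2 then even_ord r.1 else odd_ord r.1.
rewrite (reindex h) /=.
  rewrite -(pair_bigA _ (fun q b => f (h (q, b)))).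
  by apply: eq_bigr => q _; rewrite big_bool.
exists (fun p => (half_ord p, ~~ odd p)) => [[q b] _|p _].
  rewrite /h /=; case: b => /=.
    by rewrite half_even_ord mul2n odd_double.
  by rewrite half_odd_ord mul2n odd_double.
apply: val_inj; rewrite /h /=.
by case: ifP => /= op; rewrite mul2n -[RHS]odd_double_half; move: op; case: odd.
Qed.

Section SplitRow.
Variables (F K : conjTopRingType) (n : nat) (f g : K -> F) (h : F -> F -> K).

Lemma continuous_split_row : continuous f -> continuous g ->
  continuous (split_row f g : 'rV_n -> _).
Proof.
move=> fc gc; apply: continuous_mx => i p.
have -> : (fun x : 'rV_n => split_row f g x i p) =
    (if odd p then g else f) \o (fun x => x 0 (half_ord p)).
  by apply/funext => x; rewrite mxE /=; case: ifP.
by apply: continuousT_comp (@continuous_mx_entry _ _ _ _ _) _; case: ifP.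
Qed.

Lemma continuous_merge_row : continuous (fun p => h p.1 p.2) ->
  continuous (merge_row h : 'rV_(2 * n) -> _).
Proof.
move=> hc; apply: continuous_mx => i q.
have -> : (fun y => merge_row h y i q) =
    (fun p => h p.1 p.2) \o (fun y => (y 0 (even_ord q), y 0 (odd_ord q))).
  by apply/funext => y; rewrite mxE.
apply: continuousT_comp hc.
by apply: continuous_pair; exact: continuous_mx_entry.
Qed.

Lemma split_rowD : {morph f : x y / x + y} -> {morph g : x y / x + y} ->
  {morph (split_row f g : 'rV_n -> _) : x y / x + y}.
Proof.
by move=> fD gD x y; apply/rowP => p; rewrite !mxE; case: ifP; rewrite ?fD ?gD.
Qed.

Lemma split_row_alpha s t (x : 'rV_n) :
  (forall a, f (a * s) = f a * t) -> (forall a, g (a * s) = g a * t) ->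
  split_row f g (alpha s x) = alpha t (split_row f g x).
Proof.
by move=> fM gM; apply/rowP => p; rewrite !mxE; case: ifP; rewrite ?fM ?gM.
Qed.

(** Additivity of [pi] reduces the formula to a single K-coordinate, where it is the second
    hypothesis. *)
Lemma inner_split_row (pi : K -> F) (x y : 'rV_n) :
  {morph pi : a b / a + b} ->
  (forall a b, pi (conjF a * b) = conjF (f a) * f b + conjF (g a) * g b) ->
  inner (split_row f g x) (split_row f g y) = pi (inner x y).
Proof.
move=> piD piM; have pi0 : pi 0 = 0.
  by apply: (addIr (pi 0)); rewrite -piD !add0r.
rewrite /inner big_ord_even_odd (big_morph _ piD pi0).
apply: eq_bigr => q _; rewrite !mxE half_even_ord half_odd_ord piM.
by rewrite /= mul2n odd_double.
Qed.

End SplitRow.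

(** * The identifications of C^n with R^2n and of H^n with C^2n *)

Section Instances.
Variables (R : realType) (n : nat).

Lemma continuous_rC : continuous (@rC R n).
Proof.
exact: continuous_split_row (@continuous_Re R) (@continuous_Im R).
Qed.

Lemma continuous_rC_inv : continuous (@rC_inv R n).
Proof.
apply: continuous_merge_row.
exact: continuous_complex (@continuousT_fst _ _) (@continuousT_snd _ _).
Qed.

Lemma continuous_cH : continuous (@cH R n).
Proof.
apply: continuous_split_row.
  exact: continuous_complex (@continuous_qre R) (@continuous_qi R).
exact: continuous_complex (@continuous_qk R) (@continuous_qj R).
Qed.

Lemma continuous_cH_inv : continuous (@cH_inv R n).
Proof.
apply: continuous_merge_row; apply: continuous_Quat.
- exact: continuousT_comp (@continuousT_fst _ _) (@continuous_Re R).
- exact: continuousT_comp (@continuousT_fst _ _) (@continuous_Im R).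
- exact: continuousT_comp (@continuousT_snd _ _) (@continuous_Im R).
- exact: continuousT_comp (@continuousT_snd _ _) (@continuous_Re R).
Qed.

Lemma rCD : {morph @rC R n : x y / x + y}.
Proof. by apply: split_rowD => -[? ?] []. Qed.

Lemma cHD : {morph @cH R n : x y / x + y}.
Proof. by apply: split_rowD => -[? ? ? ?] []. Qed.

Lemma rC_alpha a x : @rC R n (alpha a%:C%C x) = alpha a (rC x).
Proof. by apply: split_row_alpha => -[b c] /=; ring. Qed.

(** This inclusion of C in H and the projection [complex_of_quat] play the roles of [iota] and [pi]
    over C. *)
Definition quat_of_complex (z : R[i]) : quat R :=
  Quat (complex.Re z) (complex.Im z) 0 0.

Definition complex_of_quat (q : quat R) : R[i] := Complex (qre q) (qi q).

(** Since ki = j, a quaternion is (a + bi) + k(d + ci): the two entries produced by [cH] are its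
    coordinates in the right C-basis 1, k. *)
Lemma cH_alpha z x : @cH R n (alpha (quat_of_complex z) x) = alpha z (cH x).
Proof.
by case: z => s t; apply: split_row_alpha => -[a b c d];
  congr Complex => /=; ring.
Qed.

Lemma inner_rC (x y : 'rV[R[i]]_n) :
  inner (rC x) (rC y) = complex.Re (inner x y).
Proof.
apply: inner_split_row => [[? ?] [? ?]|[a b] [c d]] //=.
by rewrite /conjF /=; ring.
Qed.

(** Write coordinates as z + kw and z' + kw'. In conj(z + kw)(z' + kw') the cross terms lie in kC,
    as moving k past a complex number conjugates it, and the last term is conj(w)(-k)k w' = conj(w)
    w'. *)
Lemma inner_cH (x y : 'rV[quat R]_n) :
  inner (cH x) (cH y) = complex_of_quat (inner x y).
Proof.
apply: inner_split_row => [[????] [????]|[a b c d] [a' b' c' d']] //=.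
by rewrite /conjF /=; congr Complex => /=; ring.
Qed.

End Instances.

(** * Index changes and the three instances of restriction of scalars *)

Definition sum_to_bool (I : Type) (s : I + I) : bool * I :=
  match s with inl l => (false, l) | inr l => (true, l) end.

Lemma sum_to_bool_bij (I : Type) : bijective (@sum_to_bool I).
Proof.
by exists (fun j : bool * I => if j.1 then inr j.2 else inl j.2) => [[]|[[]]].
Qed.

Lemma big_bool2 (V : nmodType) (f : bool * bool -> V) :
  \sum_s f s = f (true, true) + f (true, false) +
    (f (false, true) + f (false, false)).
Proof.
rewrite (eq_bigr (fun s => f (s.1, s.2))) => [|[]//].
by rewrite -(pair_bigA _ (fun s t => f (s, t))) !big_bool.
Qed.

(** The pair (b, b') stands for the unit i^b j^b', so (true, true) is ij = k. *)
Definition sum_to_bool2 (I : Type) (s : I + (I + (I + I))) :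
    (bool * bool) * I :=
  match s with
  | inl l => (false, false, l)
  | inr (inl l) => (true, false, l)
  | inr (inr (inl l)) => (false, true, l)
  | inr (inr (inr l)) => (true, true, l)
  end.

Lemma sum_to_bool2_bij (I : Type) : bijective (@sum_to_bool2 I).
Proof.
by exists (fun j : (bool * bool) * I => match j with
  | (false, false, l) => inl l
  | (true, false, l) => inr (inl l)
  | (false, true, l) => inr (inr (inl l))
  | (true, true, l) => inr (inr (inr l)) end) => [[|[|[]]]|[[[] []]]].
Qed.

Lemma complex_conj_invariant_eq1 (R : realType) (p : R[i]) :
  conjF p = p -> complex.Re p = 1 <-> p = 1.
Proof.
case: p => a b [/eqP]; rewrite eqNr => /eqP-> /=.
by split=> [->//|[]].
Qed.

(** Each imaginary coordinate equals its own negative. This yields [pi_eq1] over H. *)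
Lemma quat_conj_invariantE (R : realType) (p : quat R) :
  conjF p = p -> p = Quat (qre p) 0 0 0.
Proof.
case: p => a b c d [/eqP + /eqP + /eqP]; rewrite !eqNr.
by move=> /eqP-> /eqP-> /eqP->.
Qed.

Lemma realification_C (R : realType) (n : nat) (I : finType)
    (u : I -> 'rV[R]_(2 * n) -> 'rV[R]_(2 * n)) :
  (forall l, {within usphere (n := 2 * n), continuous u l}) ->
  lin_indep_vector_fields (fun l => rC_inv \o u l \o rC) <->
  lin_indep_vector_fields (join_family u (fun l => rC_i \o u l)).
Proof.
move=> uc; pose e (b : bool) := if b then iC R else 1.
have -> : join_family u (fun l => rC_i \o u l) =
    (fun j : bool * I => (rC \o alpha (e j.1) \o rC_inv) \o u j.2)
      \o @sum_to_bool I.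
  apply/funext => -[l|l] //=; apply/funext => x /=.
  by rewrite alpha1 rC_invK.
rewrite (lin_indep_vector_fields_reindex _ (@sum_to_bool_bij I)).
apply: (restriction_of_scalars (iota := fun a => a%:C%C)
  (pi := @complex.Re R)) => //.
(* The remaining goals are the section hypotheses of [restriction_of_scalars] in order, from
   [e_span] to [inner_phi]. *)
- move=> -[a b]; exists (fun s => if s then b else a).
  by rewrite big_bool /=; congr Complex; rewrite /=; ring.
- by move=> a; rewrite big_bool => -[] /= ? ? []; lra.
- by move=> s; exact: continuous_mulcr.
(* For p = a + bi the real parts of p and pi are a and -b. *)
- move=> [a b]; split=> [p0|[-> ->] s]; last by case: s; rewrite /=; ring.
  by have := p0 false; have /= := p0 true; move=> ? ?; congr Complex; lra.
- exact: complex_conj_invariant_eq1.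
- exact: rCK.
- exact: rC_invK.
- exact: continuous_rC.
- exact: continuous_rC_inv.
- exact: rCD.
- exact: rC_alpha.
- exact: inner_rC.
Qed.

Lemma complexification_H (R : realType) (n : nat) (I : finType)
    (v : I -> 'rV[R[i]]_(2 * n) -> 'rV[R[i]]_(2 * n)) :
  (forall l, {within usphere (n := 2 * n), continuous v l}) ->
  lin_indep_vector_fields (fun l => cH_inv \o v l \o cH) <->
  lin_indep_vector_fields (join_family v (fun l => cH_j \o v l)).
Proof.
move=> vc; pose e (b : bool) := if b then jH R else 1.
have -> : join_family v (fun l => cH_j \o v l) =
    (fun j : bool * I => (cH \o alpha (e j.1) \o cH_inv) \o v j.2)
      \o @sum_to_bool I.
  apply/funext => -[l|l] //=; apply/funext => x /=.
  by rewrite alpha1 cH_invK.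
rewrite (lin_indep_vector_fields_reindex _ (@sum_to_bool_bij I)).
apply: (restriction_of_scalars (iota := @quat_of_complex R)
  (pi := @complex_of_quat R)) => //.
- move=> -[a b c d].
  (* As ji = -k, one has j(c - di) = cj + dk; hence the sign in the coordinate along j. *)
  exists (fun s => if s then Complex c (- d) else Complex a b).
  by rewrite big_bool /=; congr Quat; rewrite /=; ring.
- move=> a; rewrite big_bool => a0.
  suff: a true = 0 /\ a false = 0 by case=> ? ? [].
  move: a0; case: (a true) (a false) => [c d] [c' d'] [] /= *.
  by split; congr Complex; lra.
- by move=> s; exact: continuous_mulqr.
(* The complex parts of p and pj are a + bi and -c - di, which together determine p. *)
- move=> [a b c d]; split=> [p0|[-> -> -> ->] s]; last first.
    by case: s; congr Complex; rewrite /=; ring.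
  have [? ?] := p0 false; have [? ?] := p0 true.
  by congr Quat; lra.
- move=> p /quat_conj_invariantE ->; split=> [|->//].
  by rewrite /complex_of_quat /= => -[->].
- exact: cHK.
- exact: cH_invK.
- exact: continuous_cH.
- exact: continuous_cH_inv.
- exact: cHD.
- exact: cH_alpha.
- exact: inner_cH.
Qed.

(** Scalars are restricted once, from H to R with basis 1, i, j, k; only the properties of [rH] are
    obtained in two stages through C. *)
Lemma realification_H (R : realType) (n : nat) (I : finType)
    (u : I -> 'rV[R]_(2 * (2 * n)) -> 'rV[R]_(2 * (2 * n))) :
  (forall l, {within usphere (n := 2 * (2 * n)), continuous u l}) ->
  lin_indep_vector_fields (fun l => rH_inv \o u l \o rH) <->
  lin_indep_vector_fields
    (join_family u
      (join_family (fun l => rH_t (iH R) \o u l)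
        (join_family (fun l => rH_t (jH R) \o u l)
                     (fun l => rH_t (kH R) \o u l)))).
Proof.
move=> uc; pose e (b : bool * bool) :=
  (if b.1 then iH R else 1) * (if b.2 then jH R else 1).
have eij : e (true, true) = kH R by congr Quat => /=; ring.
have -> : join_family u
      (join_family (fun l => rH_t (iH R) \o u l)
        (join_family (fun l => rH_t (jH R) \o u l)
                     (fun l => rH_t (kH R) \o u l))) =
    (fun j : (bool * bool) * I => (rH \o alpha (e j.1) \o rH_inv) \o u j.2)
      \o @sum_to_bool2 I.
  apply/funext => -[l|[l|[l|l]]] //=; apply/funext => x /=.
  - by rewrite /e /= mulr1 alpha1 rH_invK.
  - by rewrite /e /= mulr1.
  - by rewrite /e /= mul1r.
  - by rewrite eij.
rewrite (lin_indep_vector_fields_reindex _ (@sum_to_bool2_bij I)).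
apply: (restriction_of_scalars (iota := fun a => Quat a 0 0 0)
  (pi := @qre R)) => //.
- move=> -[a b c d].
  exists (fun s => if s.1 then if s.2 then d else b else if s.2 then c else a).
  by rewrite big_bool2 /=; congr Quat; rewrite /=; ring.
- by move=> a; rewrite big_bool2 => -[] /= + + + + [[] []]; lra.
- by move=> s; exact: continuous_mulqr.
(* The real parts of p, pi, pj, pk are a, -b, -c, -d. *)
- move=> [a b c d]; split=> [p0|[-> -> -> ->] s]; last first.
    by case: s => [[] []] /=; ring.
  have /= := p0 (false, false); have /= := p0 (false, true).
  have /= := p0 (true, false); have /= := p0 (true, true).
  by move=> ? ? ? ?; congr Quat; lra.
- by move=> p /quat_conj_invariantE ->; split=> [/= ->//|[->]].
- exact: rHK.
- exact: rH_invK.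
- exact: continuousT_comp (@continuous_cH R n) (@continuous_rC R (2 * n)).
- exact: continuousT_comp (@continuous_rC_inv R (2 * n))
    (@continuous_cH_inv R n).
- by move=> x y; rewrite /rH /= cHD rCD.
(* [Quat a 0 0 0] is the image of a under R -> C -> H, and dually [qre] is the real part of
   [complex_of_quat], so both stages compose. *)
- by move=> a x; rewrite /rH /= -rC_alpha -cH_alpha.
- by move=> x y; rewrite /rH /= inner_rC inner_cH.
Qed.

Theorem theorem4p1 (R : realType) (n m : nat)
    (n_gt0 : (0 < n)%N) (m_gt0 : (0 < m)%N) :
  (forall u : 'I_m -> 'rV[R]_(2 * n) -> 'rV[R]_(2 * n),
     lin_indep_vector_fields u ->
     (lin_indep_vector_fields (fun l => rC_inv \o u l \o rC) <->
      lin_indep_vector_fields (join_family u (fun l => rC_i \o u l))))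
  /\
  (forall v : 'I_m -> 'rV[R[i]]_(2 * n) -> 'rV[R[i]]_(2 * n),
     lin_indep_vector_fields v ->
     (lin_indep_vector_fields (fun l => cH_inv \o v l \o cH) <->
      lin_indep_vector_fields (join_family v (fun l => cH_j \o v l))))
  /\
  (forall u : 'I_m -> 'rV[R]_(2 * (2 * n)) -> 'rV[R]_(2 * (2 * n)),
     lin_indep_vector_fields u ->
     (lin_indep_vector_fields (fun l => rH_inv \o u l \o rH) <->
      lin_indep_vector_fields
        (join_family u
          (join_family (fun l => rH_t (iH R) \o u l)
            (join_family (fun l => rH_t (jH R) \o u l)
                         (fun l => rH_t (kH R) \o u l)))))).
Proof.
split=> [u [uv _]|].
  by apply: realification_C => l; have [] := uv l.
split=> u [uv _].
  by apply: complexification_H => l; have [] := uv l.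
by apply: realification_H => l; have [] := uv l.
Qed.
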